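(* Let $F$ be a monotonic (decreasing) Boolean function given by a BDD with root variable $r$, and let $S$ be the two-clauses-per-node encoding of this BDD (defined in the context). Then the encoding is consistent in the following sense: for every partial assignment $A$ to the variables of $F$, $A$ cannot be extended to a model of $F$ if and only if unit propagation on $S$ and $A$ propagates $\overline{r}$.
   Context: A Boolean function $F:\{0,1\}^k\to\{0,1\}$ is monotonic (decreasing) if every solution of $F$ (input with value 1) remains a solution after changing inputs from 1 to 0. A BDD here is a rooted binary decision diagram with terminals True and False in which every variable is tested at most once on each path (e.g. an ordered BDD with any variable ordering); it need not be reduced. Each nonterminal node has a selector variable, a false child and a true child. Two-clauses-per-node encoding: introduce one auxiliary variable for every node (terminals included; $r$ is the auxiliary variable of the root). For each nonterminal node with selector variable $x$, auxiliary variable $u$, and auxiliary variables $f$ and $t$ of its false child and true child, add the two clauses $\overline{f}\to\overline{u}$ (i.e. $f\vee\overline{u}$) and $\overline{t}\wedge x\to\overline{u}$ (i.e. $t\vee\overline{x}\vee\overline{u}$). In addition, add a unit clause consisting of the variable of the True node and a unit clause consisting of the negation of the variable of the False node. A partial assignment is a set of literals containing no pair $x,\overline{x}$; a model of $F$ is a total assignment on which $F$ has value 1. Unit propagation on a CNF $S$ and an assignment $A$: repeatedly, if some clause of $S$ has all its literals false except one undefined literal $l$, add $l$ to the assignment. *)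

(* Defs.v *)
From mathcomp Require Import all_boot.

Set Implicit Arguments.
Unset Strict Implicit.
Unset Printing Implicit Defensive.

Definition monotone_decreasing (k : nat) (F : {ffun 'I_k -> bool} -> bool) :=
  forall a b : {ffun 'I_k -> bool}, (forall i, b i -> a i) -> F a -> F b.

(* Literals, partial assignments, CNFs and unit propagation over a finite set
   V of variables. (x, true) is the literal x and (x, false) its negation. *)
Definition lit (V : finType) : finType := (V * bool)%type.
Definition pos (V : finType) (x : V) : lit V := (x, true).
Definition neg (V : finType) (x : V) : lit V := (x, false).
Definition compl (V : finType) (l : lit V) : lit V := (l.1, ~~ l.2).

Definition partial_assignment (V : finType) (A : {set lit V}) : bool :=
  [forall x : V, ~~ ((pos x \in A) && (neg x \in A))].

Definition extends (V : finType) (a : {ffun V -> bool}) (A : {set lit V}) :=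
  forall l : lit V, l \in A -> a l.1 = l.2.

Definition clause (V : finType) : finType := {set lit V}.
Definition cnf (V : finType) : finType := {set clause V}.

Definition undefined_lit (V : finType) (A : {set lit V}) (l : lit V) : bool :=
  (l \notin A) && (compl l \notin A).

Definition up_step (V : finType) (S : cnf V) : rel {set lit V} :=
  fun A A' =>
    [exists c : clause V, [exists l : lit V,
       [&& c \in S, l \in c, undefined_lit A l,
           [forall l' : lit V, (l' \in c) && (l' != l) ==> (compl l' \in A)]
         & A' == l |: A]]].

Definition propagates (V : finType) (S : cnf V) (A : {set lit V}) (l : lit V) :=
  exists2 A' : {set lit V}, connect (up_step S) A A' & l \in A'.

(* N is the type of nonterminal nodes; inl true and inl false are the True and
   False terminals, inr n is the nonterminal n. *)
Definition vertex (N : finType) : finType := (bool + N)%type.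

Definition bdd_edge (N : finType) (fchild tchild : N -> vertex N) : rel N :=
  fun m n => (fchild m == inr n) || (tchild m == inr n).

(* bdd_read_once also excludes directed cycles: going once around a cycle
   would test the selector of its first node twice. *)
Record bdd (k : nat) (N : finType) := Bdd {
  bdd_root : vertex N;
  selector : N -> 'I_k;
  fchild : N -> vertex N;
  tchild : N -> vertex N;
  bdd_read_once : forall (n : N) (p : seq N),
    path (bdd_edge fchild tchild) n p -> uniq (map selector (n :: p))
}.

Inductive bdd_eval (k : nat) (N : finType) (B : bdd k N)
    (a : {ffun 'I_k -> bool}) : vertex N -> bool -> Prop :=
| bdd_eval_terminal (b : bool) : bdd_eval B a (inl b) b
| bdd_eval_node (n : N) (b : bool) :
    bdd_eval B a (if a (selector B n) then tchild B n else fchild B n) b ->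
    bdd_eval B a (inr n) b.

Definition bdd_represents (k : nat) (N : finType) (B : bdd k N)
    (F : {ffun 'I_k -> bool} -> bool) :=
  forall a : {ffun 'I_k -> bool}, bdd_eval B a (bdd_root B) (F a).

(* The encoding uses the variables of F and one fresh variable per vertex. *)
Definition enc_var (k : nat) (N : finType) : finType := ('I_k + vertex N)%type.
Definition inp (k : nat) (N : finType) (i : 'I_k) : enc_var k N := inl i.
Definition aux (k : nat) (N : finType) (v : vertex N) : enc_var k N := inr v.

Definition inp_lit (k : nat) (N : finType) (l : lit 'I_k) : lit (enc_var k N) :=
  (inp N l.1, l.2).
Definition inp_assignment (k : nat) (N : finType) (A : {set lit 'I_k}) :
    {set lit (enc_var k N)} :=
  [set inp_lit N l | l in A].

Definition false_child_clause (k : nat) (N : finType) (B : bdd k N) (n : N) :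
    clause (enc_var k N) :=
  [set pos (aux k (fchild B n)); neg (aux k (inr n))].

Definition true_child_clause (k : nat) (N : finType) (B : bdd k N) (n : N) :
    clause (enc_var k N) :=
  [set pos (aux k (tchild B n)); neg (inp N (selector B n));
       neg (aux k (inr n))].

Definition bdd_encoding (k : nat) (N : finType) (B : bdd k N) :
    cnf (enc_var k N) :=
  [set false_child_clause B n | n : N] :|: [set true_child_clause B n | n : N]
  :|: [set [set pos (aux k (inl true : vertex N))];
           [set neg (aux k (inl false : vertex N))]].

(* Main.v *)
Require Import Defs.
From mathcomp Require Import all_boot.

Set Implicit Arguments.
Unset Strict Implicit.
Unset Printing Implicit Defensive.

(** Completeness: if [A] has no extension satisfying [F], the assignment setting
    to true exactly the positive literals of [A] falsifies [F], and [neg]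
    literals propagate backwards along its path from False to the root.
    Soundness: if [a] extends [A], every propagated [neg (aux v)] is witnessed
    by some [b <= a] whose path from [v] ends in False; being read-once, the BDD
    allows [b] to be modified freely at the selectors above [v]. At the root,
    monotonicity turns [F b = false] into [F a = false]. *)

Definition update (k : nat) (b : {ffun 'I_k -> bool}) (i : 'I_k) (c : bool) :
    {ffun 'I_k -> bool} :=
  [ffun j => if j == i then c else b j].

(** A node reaches itself and a terminal reaches nothing, so the selectors of reached nodes cover
    every variable that an evaluation from [v] can read. *)
Definition vertex_reaches (k : nat) (N : finType) (B : bdd k N)
    (v : vertex N) (n : N) : bool :=
  if v is inr m then connect (bdd_edge (fchild B) (tchild B)) m n else false.

Lemma bdd_eval_fun (k : nat) (N : finType) (B : bdd k N) a v c c' :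
  bdd_eval B a v c -> bdd_eval B a v c' -> c = c'.
Proof.
elim=> {v c} [c|n c _ IH] ev; first by inversion ev.
by inversion ev; apply: IH.
Qed.

Lemma vertex_reaches_child (k : nat) (N : finType) (B : bdd k N) n (d : bool) m :
  vertex_reaches B (if d then tchild B n else fchild B n) m ->
  exists2 x, bdd_edge (fchild B) (tchild B) n x
           & connect (bdd_edge (fchild B) (tchild B)) x m.
Proof.
by case: d; [case E: (tchild B n) => [|x] | case E: (fchild B n) => [|x]] => //=;
  exists x; rewrite // /bdd_edge E eqxx ?orbT.
Qed.

Lemma bdd_eval_agree (k : nat) (N : finType) (B : bdd k N)
    (b b' : {ffun 'I_k -> bool}) v c :
  bdd_eval B b v c ->
  (forall n, vertex_reaches B v n -> b' (selector B n) = b (selector B n)) ->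
  bdd_eval B b' v c.
Proof.
elim=> {v c} [c|n c _ IH] agree; constructor.
rewrite agree; last exact: connect0.
apply: IH => m /vertex_reaches_child[x edge_nx reach_m]; apply: agree.
exact: connect_trans (connect1 edge_nx) reach_m.
Qed.

(** The edge followed by the path to [n'] is one path from [n]; read-once makes its selectors
    distinct, and [n'] is its last node. *)
Lemma selector_fresh (k : nat) (N : finType) (B : bdd k N) (n m n' : N) :
  bdd_edge (fchild B) (tchild B) n m ->
  connect (bdd_edge (fchild B) (tchild B)) m n' ->
  selector B n' != selector B n.
Proof.
move=> edge_nm /connectP[p path_p ->].
have /= := bdd_read_once (b := B) (n := n) (p := m :: p).
rewrite edge_nm path_p => /(_ isT) /andP[n_notin _].
by apply: contra n_notin => /eqP <-; apply: (map_f (selector B)) (mem_last m p).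
Qed.

(** The update steers the evaluation at [n] into the chosen child and goes unnoticed below it, where
    the selector of [n] is not tested again. *)
Lemma bdd_eval_update (k : nat) (N : finType) (B : bdd k N) b n d c :
  bdd_eval B b (if d then tchild B n else fchild B n) c ->
  bdd_eval B (update b (selector B n) d) (inr n) c.
Proof.
move=> ev; constructor; rewrite ffunE eqxx; apply: bdd_eval_agree ev _ => m.
move=> /vertex_reaches_child[x edge_nx reach_m].
by rewrite ffunE ifN // (selector_fresh edge_nx reach_m).
Qed.

(** Asking for some [b] below [a], rather than [a] itself, avoids transferring monotonicity from the
    root to the inner nodes. *)
Definition falsifiable_below (k : nat) (N : finType) (B : bdd k N)
    (a : {ffun 'I_k -> bool}) (v : vertex N) : Prop :=
  exists2 b : {ffun 'I_k -> bool}, forall i, b i -> a i & bdd_eval B b v false.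

(** Clearing a variable always stays below [a], setting it only where [a] is true. This is why the
    true child clause mentions the selector and the false child clause does not. *)
Lemma falsifiable_below_child (k : nat) (N : finType) (B : bdd k N)
    (a : {ffun 'I_k -> bool}) n (d : bool) :
  (d -> a (selector B n)) ->
  falsifiable_below B a (if d then tchild B n else fchild B n) ->
  falsifiable_below B a (inr n).
Proof.
move=> a_sel [b le_ba ev]; exists (update b (selector B n) d).
  by move=> i; rewrite ffunE; case: eqP => [->|_]; [exact: a_sel | exact: le_ba].
exact: bdd_eval_update.
Qed.

Lemma bdd_encodingP (k : nat) (N : finType) (B : bdd k N) c :
  reflect [\/ exists n, c = false_child_clause B n,
              exists n, c = true_child_clause B n,
              c = [set pos (aux k (inl true : vertex N))]
            | c = [set neg (aux k (inl false : vertex N))]]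
          (c \in bdd_encoding B).
Proof.
rewrite !inE -orbA; apply: (iffP or4P).
- by case=> [/imsetP[n _ ->]|/imsetP[n _ ->]|/eqP->|/eqP->];
    [constructor 1; exists n | constructor 2; exists n | constructor 3 | constructor 4].
- by case=> [[n ->]|[n ->]|->|->];
    [constructor 1; exact: imset_f | constructor 2; exact: imset_f
    | constructor 3 | constructor 4].
Qed.

(* Literals [pos (aux v)] and [neg (inp i)] need no invariant: they never occur
   negated in a clause that propagates a literal of the other two kinds. *)
Definition falsifiability_invariant (k : nat) (N : finType) (B : bdd k N)
    (a : {ffun 'I_k -> bool}) (A : {set lit (enc_var k N)}) : Prop :=
  (forall v, neg (aux k v) \in A -> falsifiable_below B a v) /\
  (forall i, pos (inp N i) \in A -> a i).

Lemma up_step_falsifiability (k : nat) (N : finType) (B : bdd k N)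
    (a : {ffun 'I_k -> bool}) (A A' : {set lit (enc_var k N)}) :
  up_step (bdd_encoding B) A A' ->
  falsifiability_invariant B a A -> falsifiability_invariant B a A'.
Proof.
move=> /existsP[c /existsP[l /and5P[c_enc l_c _ /forallP others /eqP->]]] [invN invP].
have other l' : l' \in c -> l' != l -> compl l' \in A.
  by move=> l'_c l'_l; have := others l'; rewrite l'_c l'_l.
(* Two kinds of new literal meet four clause shapes. Only a negated auxiliary literal survives,
   coming from a false child clause, a true child clause or the unit clause of False. *)
split=> [v|i]; rewrite in_setU1 => /orP[/eqP l_def|];
  [subst l | exact: invN | subst l | exact: invP];
  case/bdd_encodingP: c_enc => [[n c_def]|[n c_def]|c_def|c_def];
  rewrite {}c_def in l_c other; move: l_c;
  [move=> /set2P[] | rewrite !inE -orbA => /or3P[]/eqP | move=> /set1P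
  | move=> /set1P | move=> /set2P[] | rewrite !inE -orbA => /or3P[]/eqP
  | move=> /set1P | move=> /set1P] => //.
- case=> ->; apply: (@falsifiable_below_child _ _ _ _ _ false) => //.
  by apply: invN; apply: (other (pos (aux k (fchild B n)))); [exact: set21 | exact/eqP].
- case=> v_def; subst v.
  apply: (@falsifiable_below_child _ _ _ _ _ true) => [_|].
    by apply: invP; apply: (other (neg (inp N (selector B n))));
      [rewrite !inE eqxx orbT | exact/eqP].
  by apply: invN; apply: (other (pos (aux k (tchild B n))));
    [rewrite !inE eqxx | exact/eqP].
- by case=> ->; exists a => //; constructor.
Qed.

Lemma propagates_falsifiable (k : nat) (N : finType) (B : bdd k N)
    (a : {ffun 'I_k -> bool}) (A : {set lit 'I_k}) v :
  extends a A ->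
  propagates (bdd_encoding B) (inp_assignment N A) (neg (aux k v)) ->
  falsifiable_below B a v.
Proof.
move=> ext [A' /connectP[p path_p ->]].
(* Initially there are no auxiliary literals, and [extends] covers the input literals. *)
have inv0 : falsifiability_invariant B a (inp_assignment N A).
  split=> [w|i] /imsetP[[j c] l_A] //= [-> c_def].
  by rewrite (ext _ l_A) /= -c_def.
suff [invN _] : falsifiability_invariant B a (last (inp_assignment N A) p) by exact: invN.
elim: p {A ext} (inp_assignment N A) path_p inv0 => //= A1 p IH A0 /andP[step path_p] inv0.
by apply: IH path_p _; apply: up_step_falsifiability step inv0.
Qed.

Lemma up_step_neg (V : finType) (S : cnf V) (A : {set lit V}) (c : clause V) (x : V) :
  c \in S -> neg x \in c -> pos x \notin A -> neg x \notin A ->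
  (forall l, l \in c -> l != neg x -> compl l \in A) ->
  up_step S A (neg x |: A).
Proof.
move=> c_S x_c posNA negNA others; apply/existsP; exists c; apply/existsP; exists (neg x).
apply/and5P; split=> //; first exact/andP.
by apply/forallP => l; apply/implyP => /andP[]; apply: others.
Qed.

Lemma bdd_eval_false_propagates (k : nat) (N : finType) (B : bdd k N)
    (a : {ffun 'I_k -> bool}) (A : {set lit 'I_k}) v :
  (forall i, a i -> pos i \in A) -> bdd_eval B a v false ->
  propagates (bdd_encoding B) (inp_assignment N A) (neg (aux k v)).
Proof.
move=> a_A; set A0 := inp_assignment N A; set S := bdd_encoding B.
(* Absence of [pos (aux w)] keeps the next literal to propagate undefined. *)
suff main w c : bdd_eval B a w c -> c = false -> exists A' : {set lit (enc_var k N)},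
    [/\ connect (up_step S) A0 A', neg (aux k w) \in A', A0 \subset A'
      & forall u, pos (aux k u) \notin A'].
  by move=> /main /(_ erefl) [A' [reach w_A' _ _]]; exists A'.
have extend A' u cl : connect (up_step S) A0 A' -> A0 \subset A' ->
    (forall x, pos (aux k x) \notin A') -> cl \in S -> neg (aux k u) \in cl ->
    (forall l, l \in cl -> l != neg (aux k u) -> compl l \in A') ->
    exists A'' : {set lit (enc_var k N)},
    [/\ connect (up_step S) A0 A'', neg (aux k u) \in A'', A0 \subset A''
      & forall x, pos (aux k x) \notin A''].
  move=> reach sub noPos cl_S u_cl others.
  (* A step needs an undefined literal. Keeping [A'] when the literal is already there avoids
     proving that the vertices of the path are distinct. *)
  have [u_A'|u_NA'] := boolP (neg (aux k u) \in A'); first by exists A'.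
  exists (neg (aux k u) |: A'); split.
  - by apply: connect_trans reach (connect1 _); apply: up_step_neg others.
  - exact: setU11.
  - exact: subset_trans sub (subsetUr _ _).
  - by move=> x; rewrite in_setU1 negb_or noPos andbT; apply/eqP.
elim=> {w c} [c c_false|n c _ IH /IH].
  subst c; apply: (extend A0 _ [set neg (aux k (inl false))]); rewrite ?set11 //.
  - by move=> x; apply/imsetP => -[[j d] _].
  - by apply/bdd_encodingP; constructor 4.
  - by move=> l /set1P-> /eqP.
(* The branch taken by [a] decides which clause of [n] fires; on the true branch [a_A] puts the
   selector into [A]. *)
case a_sel: (a (selector B n)) => -[A' [reach child_A' sub noPos]].
- apply: (extend A' _ (true_child_clause B n)) => //.
  + by apply/bdd_encodingP; constructor 2; exists n.
  + by rewrite !inE eqxx !orbT.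
  + move=> l; rewrite !inE -orbA => /or3P[/eqP->|/eqP->|->] // _.
    by apply: (subsetP sub); apply: (imset_f (inp_lit N) (a_A _ a_sel)).
- apply: (extend A' _ (false_child_clause B n)) => //.
  + by apply/bdd_encodingP; constructor 1; exists n.
  + by rewrite !inE eqxx !orbT.
  + by move=> l; rewrite !inE => /orP[/eqP->|->].
Qed.

Theorem theorem22 (k : nat) (N : finType) (B : bdd k N)
    (F : {ffun 'I_k -> bool} -> bool)
    (F_monotone : monotone_decreasing F) (B_represents_F : bdd_represents B F)
    (A : {set lit 'I_k}) (A_partial : partial_assignment A) :
  ~ (exists a : {ffun 'I_k -> bool}, extends a A /\ F a) <->
  propagates (bdd_encoding B) (inp_assignment N A) (neg (aux k (bdd_root B))).
Proof.
split=> [no_model|prop [a [ext Fa]]].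
(* Unassigned variables default to false, so each variable that is true under [a] has its literal in
   [A]. *)
- pose a : {ffun 'I_k -> bool} := [ffun i => pos i \in A].
  apply: (@bdd_eval_false_propagates _ _ _ a) => [i|]; first by rewrite ffunE.
  have := B_represents_F a; case Fa: (F a) => //.
  case: no_model; exists a; split=> // -[i []] l_A; rewrite ffunE //=.
  (* For a negative literal of [A], consistency of [A] excludes the positive one, so [a] is false
     there. *)
  by have /forallP/(_ i) := A_partial; rewrite (_ : neg i \in A) // andbT => /negbTE.
- have [b le_ba ev] := propagates_falsifiable ext prop.
  have := F_monotone a b le_ba Fa.
  by rewrite (bdd_eval_fun (B_represents_F b) ev).
Qed.
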